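(* Let $n\ge 2$ be an even integer and let $G(x)=x^{\frac{3^n+3}{2}}$ over $\mathbb{F}_{3^n}$. The $(-1)$-differential spectrum of $G$ is $$\mathbb S=\left\{{}_{-1}\omega_0=\frac{3^n-1}{2},\ {}_{-1}\omega_1=1,\ {}_{-1}\omega_2=\frac{3^n-1}{2}\right\}.$$
   Context: For a power function $G(x)=x^d$ over $\mathbb{F}_q$ and $c\in\mathbb{F}_q$, put ${}_c\delta_G(1,b)=\#\{x\in\mathbb{F}_q : G(x+1)-cG(x)=b\}$ and ${}_c\omega_i=\#\{b\in\mathbb{F}_q : {}_c\delta_G(1,b)=i\}$. Saying that the $c$-differential spectrum is $\mathbb S=\{{}_c\omega_{i}=v_{i},\dots\}$ means that the listed ${}_c\omega_i$ have the listed values and ${}_c\omega_j=0$ for every $j$ not listed. Here $c=-1$. *)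

(* Defs.v *)
From mathcomp Require Import all_boot all_algebra.

Set Implicit Arguments.
Unset Strict Implicit.
Unset Printing Implicit Defensive.

Import GRing.Theory.
Local Open Scope ring_scope.

Definition cdelta (F : finFieldType) (G : F -> F) (c a b : F) : nat :=
  #|[set x : F | G (x + a) - c * G x == b]|.

(* For a power function G the shift a = 1 suffices: every nonzero shift yields
   the same counts up to a rescaling of b. *)
Definition comega (F : finFieldType) (G : F -> F) (c : F) (i : nat) : nat :=
  #|[set b : F | cdelta G c 1 b == i]|.

(* Main.v *)
(* With eta the quadratic character, G(x) = eta(x) x^2, and the substitution x = y + 1 turns G(x+1) + G(x)
   into the even function H(y) = G(y-1) + G(y+1). The point is that H(y) = H(z) only if z = y or z = -y, so
   that every nonempty fibre has two elements, except the one of y = 0. When y^2 - 1 is a square, H(y) is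
   y^2 + 1 up to sign, and when it is not, H(y) is y up to sign; the two cases never give the same value,
   because (y^2 + 1)^2 - 1 = y^2 (y^2 - 1). Two values of the first kind with opposite signs would force
   y^2 + z^2 = 1; parametrising this conic by t = y + iz, where i^2 = -1, gives
   eta(y - 1) = eta(t) = eta(z - 1), as i is itself a square, and so the signs agree after all. *)
Require Import Defs.
From mathcomp Require Import all_boot all_algebra.
From mathcomp Require Import finfield zify ring.

Set Implicit Arguments.
Unset Strict Implicit.
Unset Printing Implicit Defensive.

Import GRing.Theory.
Local Open Scope ring_scope.

(** Each nonempty fibre is an orbit [{x, s x}], a singleton only at [x0]. Counting the domain by
    fibres and the codomain by values, both being [T], gives two linear equations in [N 0], [N 1]
    and [N 2]. *)
Lemma card_involution_fibers (T : finType) (f s : T -> T) (x0 : T) :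
    (forall x y, (f y == f x) = (y == x) || (y == s x)) ->
    (forall x, (s x == x) = (x == x0)) ->
  let N i := #|[set b | #|[set x | f x == b]| == i]| in
  [/\ N 0%N = ((#|T| - 1) %/ 2)%N, N 1%N = 1%N, N 2%N = ((#|T| - 1) %/ 2)%N
    & forall j : nat, j \notin [:: 0; 1; 2]%N -> N j = 0%N].
Proof.
move=> fE sE N; pose d b := #|[set x | f x == b]|.
have dE x : d (f x) = (x != x0).+1.
  rewrite /d (_ : [set _ | _] = [set x; s x]); last first.
    by apply/setP=> y; rewrite !inE fE.
  by rewrite cards2 eq_sym sE.
have d_cases b : [|| d b == 0, d b == 1 | d b == 2]%N.
  have [d0|[x]] := set_0Vmem [set x | f x == b]; first by rewrite /d d0 cards0.
  by rewrite inE => /eqP <-; rewrite dE; case: (x != x0).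
have N1 : N 1%N = 1%N.
  rewrite /N (_ : [set _ | _] = [set f x0]) ?cards1 //; apply/setP=> b.
  rewrite !inE -/(d b); apply/idP/eqP => [db|->]; last by rewrite dE eqxx.
  have /card_gt0P[x] : (0 < d b)%N by rewrite (eqP db).
  rewrite inE => /eqP fx; move: db; rewrite -fx dE.
  by have [->|] := eqVneq x x0.
have Nsum i : N i = (\sum_b (d b == i))%N.
  by rewrite /N -sum1_card big_mkcond; apply: eq_bigr => b _; rewrite inE.
have cardT : #|T| = (N 1 + N 2 * 2)%N.
  rewrite -sum1_card (partition_big f predT) //= !Nsum big_distrl -big_split /=.
  apply: eq_bigr => b _; rewrite sum1dep_card -/(d b).
  by case/or3P: (d_cases b) => /eqP ->.
have cardT' : #|T| = (N 0 + N 1 + N 2)%N.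
  rewrite -sum1_card !Nsum -!big_split /=.
  by apply: eq_bigr => b _; case/or3P: (d_cases b) => /eqP ->.
split=> //; [lia|lia|move=> j].
rewrite !inE => /norP[j0 /norP[j1 j2]].
apply/eqP; rewrite cards_eq0; apply/eqP/setP=> b; rewrite !inE -/(d b).
by case/or3P: (d_cases b) => /eqP ->; rewrite eq_sym; apply/negbTE.
Qed.

Section QuadraticCharacter.

Variables (F : finFieldType) (m : nat).
Hypothesis cardF : #|F| = (m.*2).+1.

Local Notation eta x := (x ^+ m).

Lemma eta_sqr (x : F) : x != 0 -> eta (x ^+ 2) = 1.
Proof.
move=> x0; rewrite -exprM mul2n; apply: (mulfI x0).
by rewrite -exprS -cardF expf_card mulr1.
Qed.

Lemma eta_cases (x : F) : x != 0 -> (eta x == 1) || (eta x == -1).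
Proof. by move=> x0; rewrite -eqf_sqr expr1n -exprM mulnC exprM eta_sqr. Qed.

Lemma eta_eq_mul_sqr (x y u : F) : u != 0 -> x * y = u ^+ 2 -> eta x = eta y.
Proof.
move=> u0 xy; have: x * y != 0 by rewrite xy expf_neq0.
rewrite mulf_eq0 => /norP[x0 y0].
have: eta x * eta y = 1 by rewrite -exprMn xy eta_sqr.
have y1 : eta y * eta y = 1 by rewrite -exprMn -expr2 eta_sqr.
by move=> /(congr1 ( *%R^~ (eta y))); rewrite -mulrA y1 mulr1 mul1r.
Qed.

(** Otherwise all [2m] nonzero elements would be roots of [X^m - 1], of degree [m]. *)
Lemma exists_eta_N1 : (0 < m)%N -> exists g : F, eta g = -1.
Proof.
move=> m0; have [/existsP[g /eqP g1]|] := boolP [exists g : F, eta g == -1].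
  by exists g.
move=> /existsPn noN1.
have p0 : 'X^m - 1 != 0 :> {poly F} by rewrite -size_poly_eq0 size_XnsubC.
have := max_poly_roots (rs := enum [set~ (0 : F)]) p0.
rewrite enum_uniq -cardE cardsC1 cardF size_XnsubC //= => /(_ _ isT).
suff -> : all (root ('X^m - 1)) (enum [set~ (0 : F)]) by move/(_ isT); lia.
apply/allP=> x; rewrite mem_enum !inE => x0.
have /orP[/eqP x1|] := eta_cases x0; last by rewrite (negbTE (noN1 x)).
by rewrite rootE !hornerE ?hornerXn x1 subrr.
Qed.

(** Supplies [i = w ^+ 2], a square root of -1 that is itself a square. *)
Lemma exists_root4_N1 : (0 < m)%N -> (4 %| m)%N -> exists w : F, w ^+ 4 = -1.
Proof.
move=> m0 dvd4m; have [g g1] := exists_eta_N1 m0.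
by exists (g ^+ (m %/ 4)); rewrite -exprM divnK.
Qed.

End QuadraticCharacter.

Section Char3.

Variables (F : finFieldType) (m : nat).
Hypothesis cardF : #|F| = (m.*2).+1.
Hypothesis char3 : 3%:R = 0 :> F.
Variable w : F.
Hypothesis w4 : w ^+ 4 = -1.

Local Notation eta x := (x ^+ m).

(** Reduces an identity of characteristic 3 to one that [ring] proves over any commutative ring,
    once the quotient [e] of the difference by 3 is given. *)
Lemma eq_mod3 (x y e : F) : x - y = 3%:R * e -> x = y.
Proof. by rewrite char3 mul0r => /eqP; rewrite subr_eq0 => /eqP. Qed.

Lemma w_neq0 : w != 0.
Proof.
by apply/eqP=> w0; move: w4; rewrite w0 expr0n => /eqP; rewrite eq_sym oppr_eq0 oner_eq0.
Qed.

Lemma etaN1 : eta (-1 : F) = 1.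
Proof.
by rewrite -w4 (exprM w 2 2); apply: eta_sqr => //; rewrite expf_neq0 ?w_neq0.
Qed.

Lemma etaN (x : F) : eta (- x) = eta x.
Proof. by rewrite -mulN1r exprMn etaN1 mul1r. Qed.

Lemma eta_conic (y z : F) :
  y != 1 -> z != 1 -> y ^+ 2 + z ^+ 2 = 1 -> eta (y - 1) = eta (z - 1).
Proof.
move=> y1 z1 yz; pose i := w ^+ 2; pose t := y + i * z.
have i2 : i ^+ 2 = -1 by rewrite -exprM.
have y2 : y ^+ 2 = 1 - z ^+ 2 by rewrite -yz addrK.
(* On the conic [1/t = y - i z], so, as 1/2 = -1, [y = -(t + 1/t)] and [z = i (t - 1/t)]. Moreover
   [t^2 + t + 1 = (t - 1)^2] and [t^2 + i t - 1 = (t - i)^2] in characteristic 3. *)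
have yt : (y - 1) * t = (i * (t - 1)) ^+ 2.
  by apply: (@eq_mod3 _ _ ((y - 1) * t)); rewrite /t; ring: i2 y2.
have zt : (z - 1) * t = (w * (t - i)) ^+ 2.
  rewrite exprMn -/i.
  by apply: (@eq_mod3 _ _ ((z - 1) * t)); rewrite /t; ring: i2 y2.
have t0 : t != 0.
  have: t * (y - i * z) = 1 by rewrite /t; ring: i2 y2.
  by apply: contra_eqN => /eqP ->; rewrite mul0r eq_sym oner_eq0.
have eta_t x u : x != 1 -> (x - 1) * t = u ^+ 2 -> eta (x - 1) = eta t.
  move=> x1 xt; apply: (eta_eq_mul_sqr cardF _ xt).
  have: (x - 1) * t != 0 by rewrite mulf_neq0 // subr_eq0.
  by rewrite xt expf_eq0.
by rewrite (eta_t y _ y1 yt) (eta_t z _ z1 zt).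
Qed.

Hypothesis m_gt0 : (0 < m)%N.

Definition shifted_sum (y : F) : F :=
  eta (y - 1) * (y - 1) ^+ 2 + eta (y + 1) * (y + 1) ^+ 2.

Lemma one_neqN1 : (1 == -1 :> F) = false.
Proof.
apply/eqP=> e; have: 1 - -1 = -1 :> F by apply: (@eq_mod3 _ _ 1); ring.
by rewrite -e subrr => /eqP; rewrite eq_sym oner_eq0.
Qed.

Lemma eta0 : eta (0 : F) = 0.
Proof. by rewrite expr0n -[m]prednK. Qed.

Lemma zero_neqN1 : (0 == -1 :> F) = false.
Proof. by rewrite eq_sym oppr_eq0 oner_eq0. Qed.

(** Equal characters at [y - 1] and [y + 1] add the two squares, giving [2 (y^2 + 1)] up to sign;
    opposite ones subtract them, leaving [4 y] up to sign. At [y = 1] and [y = -1] one term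
    vanishes, whence [!= -1] instead of [= 1], and the guard [y != 1]. *)
Lemma shifted_sum_cases y :
  [\/ [/\ shifted_sum y = - (y ^+ 2 + 1), eta (y ^+ 2 - 1) != -1
         & y != 1 -> eta (y - 1) = 1],
      [/\ shifted_sum y = y ^+ 2 + 1, eta (y ^+ 2 - 1) != -1, y != 1
         & eta (y - 1) = -1]
    | shifted_sum y ^+ 2 = y ^+ 2 /\ eta (y ^+ 2 - 1) = -1].
Proof.
rewrite /shifted_sum; have [->|y1] := eqVneq y 1.
  have two : 1 + 1 = -1 :> F by apply: (@eq_mod3 _ _ 1); ring.
  apply: Or31; rewrite expr1n two subrr eta0 zero_neqN1 etaN1.
  by split=> //; ring.
have [->|yN1] := eqVneq y (-1).
  apply: Or31; rewrite sqrrN expr1n addNr subrr eta0 eq_sym oppr_eq0 oner_eq0.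
  have -> : -1 - 1 = 1 :> F by apply: (@eq_mod3 _ _ (-1)); ring.
  by split=> //; rewrite ?expr1n //; apply: (@eq_mod3 _ _ 1); ring.
have -> : y ^+ 2 - 1 = (y - 1) * (y + 1) by ring.
rewrite exprMn.
have ym : y - 1 != 0 by rewrite subr_eq0.
have yp : y + 1 != 0 by rewrite addr_eq0.
case/orP: (eta_cases cardF ym) => /eqP ->;
  case/orP: (eta_cases cardF yp) => /eqP ->.
- apply: Or31; rewrite mulr1 one_neqN1; split=> //.
  by apply: (@eq_mod3 _ _ (y ^+ 2 + 1)); ring.
- apply: Or33; split; last by ring.
  by apply: (@eq_mod3 _ _ (5%:R * y ^+ 2)); ring.
- apply: Or33; split; last by ring.
  by apply: (@eq_mod3 _ _ (5%:R * y ^+ 2)); ring.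
- apply: Or32; rewrite mulrNN mulr1 one_neqN1; split=> //.
  by apply: (@eq_mod3 _ _ (- (y ^+ 2 + 1))); ring.
Qed.

Lemma sqr_plus1_neq_sqr (y z : F) :
  eta (y ^+ 2 - 1) != -1 -> eta (z ^+ 2 - 1) = -1 -> (y ^+ 2 + 1) ^+ 2 <> z ^+ 2.
Proof.
move=> ey ez yz; move: ez; rewrite -yz.
have -> : (y ^+ 2 + 1) ^+ 2 - 1 = y ^+ 2 * (y ^+ 2 - 1).
  by apply: (@eq_mod3 _ _ (y ^+ 2)); ring.
(* The case [y = 0] is apart: there [y ^+ 2] has character 0, not 1. *)
rewrite exprMn; have [->|y0] := eqVneq y 0.
  by move=> /eqP; rewrite expr0n eta0 mul0r zero_neqN1.
by rewrite (eta_sqr cardF y0) mul1r; apply/eqP.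
Qed.

Lemma opposite_signs (y z : F) :
    (y != 1 -> eta (y - 1) = 1) -> z != 1 -> eta (z - 1) = -1 ->
  - (y ^+ 2 + 1) <> z ^+ 2 + 1.
Proof.
move=> ey z1 ez yz.
have yz1 : y ^+ 2 + z ^+ 2 = 1.
  have -> : y ^+ 2 + z ^+ 2 = z ^+ 2 + 1 - - (y ^+ 2 + 1) - 2%:R by ring.
  by rewrite yz subrr; apply: (@eq_mod3 _ _ (-1)); ring.
(* [eta_conic] excludes [y = 1]; there the conic forces [z = 0], and [etaN1] contradicts [ez]. *)
have [y1|y1] := eqVneq y 1.
  have /eqP : z ^+ 2 = 0 by rewrite -[RHS](subrr 1) -{1}yz1 y1 expr1n; ring.
  rewrite sqrf_eq0 => /eqP z0; move: ez; rewrite z0 sub0r etaN1.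
  by move/eqP; rewrite one_neqN1.
move: (eta_conic y1 z1 yz1); rewrite ey // ez.
by move/eqP; rewrite one_neqN1.
Qed.

Lemma shifted_sumN y : shifted_sum (- y) = shifted_sum y.
Proof.
rewrite /shifted_sum addrC.
have -> : - y + 1 = - (y - 1) by ring.
have -> : - y - 1 = - (y + 1) by ring.
by rewrite !etaN !sqrrN.
Qed.

Lemma shifted_sumE y z :
  (shifted_sum y == shifted_sum z) = (y == z) || (y == - z).
Proof.
apply/idP/orP=> [/eqP e|[]/eqP->//]; last by rewrite shifted_sumN.
apply/orP; rewrite -eqf_sqr; apply/eqP.
(* Two values of the same kind and sign give [y ^+ 2 = z ^+ 2]; the mixed cases are
   contradictory. *)
case: (shifted_sum_cases y) => [[Hy ey sy]|[Hy ey y1 sy]|[Hy ey]];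
  case: (shifted_sum_cases z) => [[Hz ez sz]|[Hz ez z1 sz]|[Hz ez]].
- by apply: (addIr 1); apply: oppr_inj; rewrite -Hy -Hz.
- by case: (opposite_signs sy z1 sz); rewrite -Hy -Hz.
- by case: (sqr_plus1_neq_sqr ey ez); rewrite -Hz -e Hy sqrrN.
- by case: (opposite_signs sz y1 sy); rewrite -Hy -Hz.
- by apply: (addIr 1); rewrite -Hy -Hz.
- by case: (sqr_plus1_neq_sqr ey ez); rewrite -Hz -e Hy.
- by case: (sqr_plus1_neq_sqr ez ey); rewrite -Hy e Hz sqrrN.
- by case: (sqr_plus1_neq_sqr ez ey); rewrite -Hy e Hz.
- by rewrite -Hy -Hz e.
Qed.

End Char3.

Theorem theorem9 (n : nat) (F : finFieldType)
    (n_ge2 : (2 <= n)%N) (n_even : ~~ odd n) (cardF : #|F| = (3 ^ n)%N) :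
  let G := fun x : F => x ^+ ((3 ^ n + 3) %/ 2)%N in
  [/\ comega G (-1) 0 = ((3 ^ n - 1) %/ 2)%N,
      comega G (-1) 1 = 1%N,
      comega G (-1) 2 = ((3 ^ n - 1) %/ 2)%N
    & forall j : nat, j \notin [:: 0; 1; 2]%N -> comega G (-1) j = 0%N].
Proof.
move=> G.
(* As [n] is even and 9 is 1 modulo 8, [(3 ^ n - 1) / 2] is a multiple of 4, as the fourth root of
   -1 requires. *)
have [k k_gt0 q_eq] : exists2 k, (0 < k)%N & (3 ^ n = (4 * k).*2.+1)%N.
  have: (8 %| 3 ^ n - 1)%N.
    rewrite -eqn_mod_dvd ?expn_gt0 // -(odd_double_half n) (negbTE n_even).
    by rewrite -mul2n expnM -modnXm exp1n.
  have: (3 ^ 2 <= 3 ^ n)%N by rewrite leq_exp2l.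
  move=> n9 /dvdnP[k qk]; exists k; lia.
pose m := (4 * k)%N.
have m_gt0 : (0 < m)%N by rewrite muln_gt0.
have cardFm : #|F| = m.*2.+1 by rewrite cardF.
have char3 : 3%:R = 0 :> F.
  by have /andP[_ /eqP] := card_finPcharP cardF (isT : prime 3).
have [w w4] := exists_root4_N1 cardFm m_gt0 (dvdn_mulr _ (dvdnn 4)).
have GE x : G x = x ^+ m * x ^+ 2.
  by rewrite /G q_eq -exprD; congr (_ ^+ _); rewrite -/m; lia.
have sumE x : G (x + 1) - -1 * G x = shifted_sum m (x - 1).
  rewrite /shifted_sum !GE subrK mulN1r opprK.
  by have -> : x - 1 - 1 = x + 1 by apply: (eq_mod3 char3 (e := -1)); ring.
(* With [y = x - 1], the symmetry [y -> - y] becomes [x -> - x - 1], since 2 = -1; its fixed point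
   [y = 0] is [x = 1]. *)
have symE (x : F) : x - 1 = - (- x - 1 - 1).
  by apply: (eq_mod3 char3 (e := -1)); ring.
rewrite -cardF.
apply: (card_involution_fibers (f := fun x => G (x + 1) - -1 * G x)
  (s := fun x => - x - 1) (x0 := 1)) => [x y|x].
  rewrite !sumE (shifted_sumE cardFm char3 w4 m_gt0) (inj_eq (addIr _)).
  by rewrite (symE x) opprK (inj_eq (addIr _)).
by rewrite -subr_eq0 -[RHS]subr_eq0; congr (_ == 0);
  apply: (eq_mod3 char3 (e := - x)); ring.
Qed.
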